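(* Let $(\beta,\le)$ be a well-ordered basis of a vector space $\mathcal{V}$ over a field $\mathbb{F}$, let $G$ be a group, and let $\Gamma$ be a good $G$-grading on an algebra $\mathcal{A}$, where $\mathrm{UT}^{\mathrm{fin}}_\beta\mathcal{V}\subseteq\mathcal{A}\subseteq\mathrm{UT}_\beta\mathcal{V}$. Then $\Gamma$ is finite.
   Context: $\mathrm{UT}_\beta\mathcal{V}$ is the algebra of all $t\in\mathrm{End}_{\mathbb{F}}\mathcal{V}$ with $t(v)\in\mathrm{Span}\{w\in\beta\mid w\le v\}$ for all $v\in\beta$, and $\mathrm{UT}^{\mathrm{fin}}_\beta\mathcal{V}=\{t\in\mathrm{UT}_\beta\mathcal{V}\mid\dim t(\mathcal{V})<\infty\}$. For $u,v\in\beta$, $e_{uv}\in\mathrm{End}_{\mathbb{F}}\mathcal{V}$ is defined by $e_{uv}(v)=u$ and $e_{uv}(w)=0$ for $w\in\beta\setminus\{v\}$. A $G$-grading on $\mathcal{A}$ is a vector space decomposition $\mathcal{A}=\bigoplus_{g\in G}\mathcal{A}_g$ with $\mathcal{A}_g\mathcal{A}_h\subseteq\mathcal{A}_{gh}$. It is good if every $e_{uv}$ with $u\le v$ in $\beta$ is homogeneous (lies in some $\mathcal{A}_g$), and finite if its support $\{g\in G\mid\mathcal{A}_g\ne0\}$ is finite. *)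

(* Defs.v *)
From HB Require Import structures.
From mathcomp Require Import all_boot ssralg.
From mathcomp Require Import mathcomp_extra boolp wochoice classical_sets.
From mathcomp Require Import functions cardinality fsbigop.

Set Implicit Arguments.
Unset Strict Implicit.
Unset Printing Implicit Defensive.

Import GRing.Theory.

Local Open Scope classical_set_scope.
Local Open Scope ring_scope.

Section LinearAlgebra.
Variables (F : fieldType) (U : lmodType F).
Implicit Types (S B : set U).

Definition subspace S :=
  S 0 /\ forall (a : F) (x y : U), S x -> S y -> S (a *: x + y).

Definition lin_span B : set U :=
  [set x | exists2 c : U -> F,
     finite_set [set w | c w != 0] & x = \sum_(w \in B) c w *: w].

Definition lin_free B := forall c : U -> F,
  finite_set [set w | c w != 0] ->
  \sum_(w \in B) c w *: w = 0 -> forall w, B w -> c w = 0.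

Definition lin_basis B := lin_free B /\ lin_span B = setT.

Definition finite_dim S := exists2 B : set U, finite_set B & S = lin_span B.

Definition direct_sum (I : choiceType) (W : I -> set U) S :=
  [/\ forall i, subspace (W i),
      forall i, W i `<=` S &
      forall x, S x -> exists! y : I -> U,
        [/\ forall i, W i (y i),
            finite_set [set i | y i != 0] &
            x = \sum_(i \in [set: I]) y i]].

Lemma lin_sumE B (c : U -> F) (r : seq U) :
  uniq r -> (forall w, c w != 0 -> w \in r) ->
  \sum_(w \in B) c w *: w = \sum_(w <- r | w \in B) c w *: w.
Proof.
move=> ur cr; rewrite (fsbigE [seq w <- r | w \in B]) ?filter_uniq //.
- by rewrite big_filter_cond; apply: eq_bigl => w; rewrite andbb.
- by move=> w /=; rewrite mem_filter => /andP[/set_mem].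
move=> w Bw; rewrite mem_filter (mem_set Bw) /= => wr.
have [->|/cr] := eqVneq (c w) 0; first by rewrite scale0r.
by rewrite (negPf wr).
Qed.

Lemma lin_sumP B (a : F) (c d : U -> F) :
  finite_set [set w | c w != 0] -> finite_set [set w | d w != 0] ->
  finite_set [set w | a * c w + d w != 0] /\
  \sum_(w \in B) (a * c w + d w) *: w =
    a *: (\sum_(w \in B) c w *: w) + \sum_(w \in B) d w *: w.
Proof.
move=> /finite_seqP[r cr] /finite_seqP[s ds].
have rP w : c w != 0 -> w \in undup (r ++ s).
  by move=> cw; rewrite mem_undup mem_cat (_ : w \in r) //; have: [set` r] w by rewrite -cr.
have sP w : d w != 0 -> w \in undup (r ++ s).
  by move=> dw; rewrite mem_undup mem_cat orbC (_ : w \in s) //; have: [set` s] w by rewrite -ds.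
have rsP w : a * c w + d w != 0 -> w \in undup (r ++ s).
  have [/eqP c0|/negPf c0] := boolP (c w == 0); last by rewrite rP ?c0.
  by rewrite c0 mulr0 add0r => /sP.
split.
  by apply: sub_finite_set (finite_seq (undup (r ++ s))) => w /=; apply: rsP.
rewrite !(@lin_sumE _ _ (undup (r ++ s))) ?undup_uniq //.
rewrite scaler_sumr -big_split; apply: eq_bigr => w _.
by rewrite scalerDl scalerA.
Qed.

End LinearAlgebra.

Section UpperTriangular.
Variables (F : fieldType) (V : lmodType F).
Variables (beta : set V) (le : rel V).

(* [wo_chain le beta]: every nonempty subset of beta has a unique minimum;    *)
(* applied to subsets with at most three elements, this makes [le] a total    *)
(* order on beta.  Nothing is required of [le] outside beta.                  *)
Definition well_ordered_basis := lin_basis beta /\ wo_chain le (mem beta).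

(* Endomorphisms are the elements of the F-space V -> V (with pointwise       *)
(* operations) satisfying [linear]; their product is composition.             *)
Definition UT : set (V -> V) :=
  [set t | linear t /\
     forall v, beta v -> lin_span [set w | beta w /\ le w v] (t v)].

Definition UTfin : set (V -> V) := [set t | UT t /\ finite_dim (range t)].

Definition is_matrix_unit (u v : V) (t : V -> V) :=
  [/\ linear t, t v = u & forall w, beta w -> w != v -> t w = 0].

(* By [matrix_unitP] and [is_matrix_unit_inj], this is the only map satisfying *)
(* [is_matrix_unit u v] when beta is a basis; the default 0 is not used.      *)
Definition matrix_unit (u v : V) : V -> V := xget 0 (is_matrix_unit u v).

Lemma matrix_unitP (u v : V) :
  lin_basis beta -> beta v -> is_matrix_unit u v (matrix_unit u v).
Proof.
move=> [bfree bspan] bv.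
suff [t tP] : exists t, is_matrix_unit u v t by exact: (xgetI 0 tP).
have /choice[k kP] : forall x, exists c : V -> F,
    finite_set [set w | c w != 0] /\ x = \sum_(w \in beta) c w *: w.
  move=> x; have : lin_span beta x by rewrite bspan.
  by case=> c cfin cx; exists c.
have kU x (c : V -> F) w : beta w -> finite_set [set w | c w != 0] ->
    x = \sum_(w \in beta) c w *: w -> k x w = c w.
  move=> bw cfin cx; have [kfin kx] := kP x.
  have [dfin dx] := lin_sumP beta (-1) kfin cfin.
  have := bfree _ dfin; rewrite dx -kx -cx scaleN1r addNr => /(_ erefl w bw).
  by rewrite mulN1r => /eqP; rewrite addrC subr_eq0 => /eqP.
have kbasis w : beta w -> k w v = (w == v)%:R.
  move=> bw; have supp w' : (w' == w)%:R != 0 :> F -> w' \in [:: w].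
    by rewrite inE; case: (w' == w); rewrite //= eqxx.
  rewrite (kU w (fun w' => (w' == w)%:R) v bv) ?[v == w]eq_sym //.
    by apply: sub_finite_set (finite_seq [:: w]) => w'; apply: supp.
  by rewrite (lin_sumE _ _ supp) // big_cons big_nil mem_set // eqxx scale1r addr0.
exists (fun x => k x v *: u); split.
- move=> a x y; have [kx ex] := kP x; have [ky ey] := kP y.
  have [kfin kxy] := lin_sumP beta a kx ky.
  rewrite (kU (a *: x + y) (fun w => a * k x w + k y w)) //.
    by rewrite scalerDl scalerA.
  by rewrite kxy -ex -ey.
- by rewrite kbasis // eqxx scale1r.
by move=> w bw /negPf wv; rewrite kbasis // wv scale0r.
Qed.

Lemma is_matrix_unit_inj (u v : V) (s t : V -> V) : lin_basis beta ->
  is_matrix_unit u v s -> is_matrix_unit u v t -> s = t.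
Proof.
move=> [_ bspan] [slin sv s0] [tlin tv t0]; apply/funext => x.
pose sL := GRing.isLinear.Build F V V *:%R s slin.
pose tL := GRing.isLinear.Build F V V *:%R t tlin.
pose s' : {linear V -> V} := HB.pack s sL.
pose t' : {linear V -> V} := HB.pack t tL.
have : lin_span beta x by rewrite bspan.
case=> c /finite_seqP[r cr] ->.
have rP w : c w != 0 -> w \in undup r.
  by move=> cw; rewrite mem_undup; have: [set` r] w by rewrite -cr.
rewrite (lin_sumE _ (undup_uniq r) rP) -[s]/(s' : V -> V) -[t]/(t' : V -> V).
rewrite !linear_sum; apply: eq_bigr => w /set_mem bw.
rewrite !linearZ; congr (_ *: _); rewrite /=.
by have [->|wv] := eqVneq w v; rewrite ?sv ?tv ?s0 ?t0.
Qed.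

(* Not necessarily unital: [UTfin] has no identity when beta is infinite.     *)
Definition subalgebra (A : set (V -> V)) :=
  [/\ A `<=` [set t | linear t], subspace A &
      forall s t, A s -> A t -> A (s \o t)].

Definition grading (G : groupType) (A : set (V -> V))
    (Gamma : G -> set (V -> V)) :=
  direct_sum Gamma A /\
  forall g h s t, Gamma g s -> Gamma h t -> Gamma (g * h)%g (s \o t).

Definition homogeneous (G : groupType) (Gamma : G -> set (V -> V))
    (t : V -> V) :=
  exists g, Gamma g t.

Definition good (G : groupType) (Gamma : G -> set (V -> V)) :=
  forall u v, beta u -> beta v -> le u v ->
    homogeneous Gamma (matrix_unit u v).

Definition grading_support (G : groupType) (Gamma : G -> set (V -> V)) : set G :=
  [set g | Gamma g <> [set 0]].

Definition finite_grading (G : groupType) (Gamma : G -> set (V -> V)) :=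
  finite_set (grading_support Gamma).

End UpperTriangular.

(* Main.v *)
(* Let o be the minimum of beta and let e_{ov} have degree d v.  The rank-one   *)
(* map t sending every basis vector to o lies in A and satisfies                *)
(* t e_{vv} = e_{ov}, so the component of t of degree d v is nonzero; hence d   *)
(* takes finitely many values on beta.  From e_{ou} e_{uv} = e_{ov}, the degree *)
(* of e_{uv} is (d u)^-1 (d v), and a nonzero homogeneous a satisfies           *)
(* e_{uu} a e_{vv} = c e_{uv} with c nonzero for some u, v, so its degree is    *)
(* again of this form.                                                          *)
From HB Require Import structures.
Require Import Defs.
From mathcomp Require Import all_boot ssralg.
From mathcomp Require Import mathcomp_extra boolp wochoice classical_sets.
From mathcomp Require Import functions cardinality fsbigop.

Set Implicit Arguments.
Unset Strict Implicit.

Import GRing.Theory.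

Local Open Scope classical_set_scope.

(** The well-order enters through its minimum o: every e_{ov} is then upper triangular, hence
    homogeneous, and the finite-rank map t of [UTfin_const] sees all of these units at once, since t
    e_{vv} = e_{ov}. As an element of [A], t has only finitely many nonzero homogeneous components.
    Right multiplication by e_{vv}, which has degree 1 by [degree_diag], preserves degrees, so
    [finite_degree_first_row] finds every degree of the first row among those of t.
    [degree_matrix_unit] and [degree_neq0] then confine the support to quotients g^-1 h of these
    finitely many degrees. *)

(** * Linear maps and bases, with finite-support sums turned into sums over lists *)

Section LinearMaps.
Local Open Scope ring_scope.
Variables (F : fieldType) (U V : lmodType F).

Lemma linear_sum_scale (t : U -> V) (I : Type) (r : seq I) (P : pred I)
    (c : I -> F) (f : I -> U) : linear t ->
  t (\sum_(i <- r | P i) c i *: f i) = \sum_(i <- r | P i) c i *: t (f i).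
Proof.
move=> tlin; pose tL := GRing.isLinear.Build F U V *:%R t tlin.
pose t' : {linear U -> V} := HB.pack t tL.
rewrite -[t]/(t' : U -> V) linear_sum; apply: eq_bigr => i _.
by rewrite linearZ.
Qed.

Lemma linear_fun0 (t : U -> V) : linear t -> t 0 = 0.
Proof.
by move=> /(linear_sum_scale [::] xpredT (fun=> 0) id); rewrite !big_nil.
Qed.

Lemma lin_span_scale (B : set U) a w : B w -> lin_span B (a *: w).
Proof.
move=> Bw; pose c w' := if w' == w then a else 0.
have cP w' : c w' != 0 -> w' \in [:: w].
  by rewrite inE /c; case: ifP; rewrite ?eqxx.
exists c; first by apply: sub_finite_set (finite_seq [:: w]) => w'; apply: cP.
by rewrite (lin_sumE _ _ cP) // big_cons big_nil mem_set // /c eqxx addr0.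
Qed.

Lemma lin_spanP (B : set U) x : lin_span B x ->
  exists (r : seq U) (c : U -> F), [/\ uniq r,
    forall w, c w != 0 -> w \in r & x = \sum_(w <- r | w \in B) c w *: w].
Proof.
move=> [c /finite_seqP[r cr] ->].
have rP w : c w != 0 -> w \in undup r.
  by move=> cw; rewrite mem_undup; have: [set` r] w by rewrite -cr.
by exists (undup r), c; split; rewrite ?undup_uniq // (lin_sumE _ _ rP) ?undup_uniq.
Qed.

Lemma linear_basis_eq (B : set U) (s t : U -> V) : lin_span B = setT ->
  linear s -> linear t -> (forall w, B w -> s w = t w) -> s = t.
Proof.
move=> Bspan slin tlin st; apply/funext => x.
have /lin_spanP[r [c [_ _ ->]]] : lin_span B x by rewrite Bspan.
rewrite !linear_sum_scale //; apply: eq_bigr => w /set_mem Bw.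
by rewrite st.
Qed.

(** Coordinates on [B] are unique, so applying [f] termwise to any expansion of x gives the same
    vector; this independence ([tE]) also yields linearity. *)
Lemma linear_extension (B : set U) (f : U -> V) : lin_basis B ->
  exists2 t : U -> V, linear t & forall w, B w -> t w = f w.
Proof.
move=> [Bfree Bspan].
have fin (c : U -> F) (r : seq U) : (forall w, c w != 0 -> w \in r) ->
    finite_set [set w | c w != 0].
  by move=> cr; apply: sub_finite_set (finite_seq r) => w; apply: cr.
have /choice[k kP] : forall x, exists rc : seq U * (U -> F), [/\ uniq rc.1,
    forall w, rc.2 w != 0 -> w \in rc.1 &
    x = \sum_(w <- rc.1 | w \in B) rc.2 w *: w].
  move=> x; have /lin_spanP[r [c rc]] : lin_span B x by rewrite Bspan.
  by exists (r, c).
pose t x := \sum_(w <- (k x).1 | w \in B) (k x).2 w *: f w.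
have tE x (r : seq U) (c : U -> F) : uniq r -> (forall w, c w != 0 -> w \in r) ->
    x = \sum_(w <- r | w \in B) c w *: w ->
    t x = \sum_(w <- r | w \in B) c w *: f w.
  move=> ur cr xE; have [] := kP x; rewrite /t; case: (k x) => r' c' /= ur' cr'.
  rewrite -(lin_sumE _ ur' cr') {1}xE -(lin_sumE _ ur cr) => cc'.
  (* The difference of the two expansions is a vanishing combination, so freeness forces equal
     coefficients, but only on [B]; outside [B] they stay arbitrary. *)
  have [dfin dE] := lin_sumP B (-1) (fin _ _ cr) (fin _ _ cr').
  have {cc' dE}eqc w : B w -> c w = c' w.
    move=> Bw; have := Bfree _ dfin; rewrite dE cc' scaleN1r addNr.
    by move=> /(_ erefl w Bw)/eqP; rewrite mulN1r addrC subr_eq0 => /eqP.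
  (* both sums are supported on the common part of r and r' *)
  have restr (s s' : seq U) (b b' : U -> F) : (forall w, b' w != 0 -> w \in s') ->
      (forall w, B w -> b w = b' w) ->
      \sum_(w <- s | w \in B) b w *: f w =
      \sum_(w <- [seq w <- s | w \in s'] | w \in B) b w *: f w.
    move=> bs' bb'; rewrite big_filter_cond [LHS]big_mkcond [RHS]big_mkcond.
    apply: eq_bigr => w _; case: ifPn => [/set_mem Bw|]; rewrite ?andbF //.
    rewrite andbT; case: ifPn => // /(contra (bs' w)).
    by rewrite negbK bb' // => /eqP ->; rewrite scale0r.
  rewrite (restr _ r _ c cr) => [|w /eqc //].
  rewrite [RHS](restr _ r' _ c' cr') //.
  rewrite (perm_big [seq w <- r | w \in r']) /=; last first.
    by apply: uniq_perm; rewrite ?filter_uniq // => w; rewrite !mem_filter andbC.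
  by apply: eq_bigr => w /set_mem /eqc ->.
exists t; last first.
  move=> w Bw; rewrite (tE w [:: w] (fun w' => (w' == w)%:R)) //.
  - by rewrite big_cons big_nil mem_set // eqxx scale1r addr0.
  - by move=> w'; rewrite inE; case: (w' == w); rewrite //= eqxx.
  by rewrite big_cons big_nil mem_set // eqxx scale1r addr0.
move=> a x y; have [ux cx xE] := kP x; have [uy cy yE] := kP y.
(* A common list for x and y lets their coefficients be added termwise. *)
set r := undup ((k x).1 ++ (k y).1).
have ur : uniq r by apply: undup_uniq.
have xr w : (k x).2 w != 0 -> w \in r.
  by move=> /cx wx; rewrite mem_undup mem_cat wx.
have yr w : (k y).2 w != 0 -> w \in r.
  by move=> /cy wy; rewrite mem_undup mem_cat wy orbT.
have xE' : x = \sum_(w <- r | w \in B) (k x).2 w *: w.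
  by rewrite {1}xE -(lin_sumE _ ux cx) (lin_sumE _ ur xr).
have yE' : y = \sum_(w <- r | w \in B) (k y).2 w *: w.
  by rewrite {1}yE -(lin_sumE _ uy cy) (lin_sumE _ ur yr).
rewrite (tE x r _ ur xr xE') (tE y r _ ur yr yE').
rewrite (tE (a *: x + y) r (fun w => a * (k x).2 w + (k y).2 w) ur).
- rewrite scaler_sumr -big_split; apply: eq_bigr => w _.
  by rewrite scalerDl scalerA.
- move=> w; have [->|/xr //] := eqVneq ((k x).2 w) 0.
  by rewrite mulr0 add0r => /yr.
rewrite {1}xE' {1}yE' scaler_sumr -big_split; apply: eq_bigr => w _.
by rewrite scalerDl scalerA.
Qed.

Lemma single_support (I : choiceType) (i : I) (x : U) :
  finite_set [set j | (if j == i then x else 0) != 0].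
Proof.
apply: sub_finite_set (finite_seq [:: i]) => j /=; rewrite inE.
by case: ifP; rewrite ?eqxx.
Qed.

Lemma fsum_single (I : choiceType) (i : I) (x : U) :
  \sum_(j \in [set: I]) (if j == i then x else 0) = x.
Proof.
rewrite (fsbigE [:: i]) //.
  by rewrite big_cons big_nil mem_set //= eqxx addr0.
by move=> j _; rewrite inE => /negPf ->.
Qed.

End LinearMaps.

(** * Uniqueness of components in a direct sum *)

Section DirectSum.
Local Open Scope ring_scope.
Variables (F : fieldType) (U : lmodType F) (I : choiceType).
Variables (W : I -> set U) (S : set U).
Hypothesis WS : direct_sum W S.

(** The family equal to x at [i] and 0 elsewhere also decomposes x, so it coincides with [y]. *)
Lemma direct_sum_component (i : I) (x : U) (y : I -> U) : W i x ->
  (forall j, W j (y j)) -> finite_set [set j | y j != 0] ->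
  x = \sum_(j \in [set: I]) y j -> y i = x.
Proof.
have [Wsub WleS decomp] := WS => Wx Wy yfin xE.
have [z [_ zuniq]] := decomp x (WleS _ _ Wx).
rewrite -(zuniq y) // (zuniq (fun j => if j == i then x else 0)) ?eqxx //.
split; last by rewrite fsum_single.
  by move=> j; case: eqP => [->|_] //; case: (Wsub j).
exact: single_support.
Qed.

Lemma direct_sum_index_uniq (i j : I) (x : U) :
  x != 0 -> W i x -> W j x -> i = j.
Proof.
have [Wsub _ _] := WS => x0 Wi Wj; apply/eqP; apply: contraNT x0 => ij.
(* The family concentrated at [j] has the value 0 at [i], which would force x = 0. *)
rewrite -(@direct_sum_component i x (fun l => if l == j then x else 0)) //.
- by rewrite (negPf ij).
- by move=> l; case: eqP => [->|_] //; case: (Wsub l).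
- exact: single_support.
by rewrite fsum_single.
Qed.

End DirectSum.

(** * Calculus of matrix units *)

Section MatrixUnits.
Local Open Scope ring_scope.
Variables (F : fieldType) (V : lmodType F) (beta : set V).
Hypothesis bbasis : lin_basis beta.

Lemma lin_basis_neq0 v : beta v -> v != 0.
Proof.
move=> bv; apply/eqP => v0; have [bfree _] := bbasis.
have supp w : (w == v)%:R != 0 :> F -> w \in [:: v].
  by rewrite inE; case: (w == v); rewrite //= eqxx.
have dfin : finite_set [set w | (w == v)%:R != 0 :> F].
  by apply: sub_finite_set (finite_seq [:: v]) => w; apply: supp.
have := bfree _ dfin; rewrite (lin_sumE _ _ supp) // big_cons big_nil mem_set //.
rewrite v0 scaler0 addr0 -v0 => /(_ erefl v bv)/eqP.
by rewrite eqxx oner_eq0.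
Qed.

Lemma matrix_unit_neq0 u v : beta u -> beta v -> matrix_unit beta u v != 0.
Proof.
move=> bu bv; have [_ uE _] := matrix_unitP u bbasis bv.
by apply: contraNneq (lin_basis_neq0 bu) => E0; rewrite -uE E0.
Qed.

(** The first index [s u] may be any vector, so this one rule covers both e_{ou} e_{uv} = e_{ov} and
    products that give multiples of a unit. *)
Lemma comp_matrix_unit (s : V -> V) u v : linear s -> beta v ->
  s \o matrix_unit beta u v = matrix_unit beta (s u) v.
Proof.
move=> slin bv; have [elin ev e0] := matrix_unitP u bbasis bv.
apply: (is_matrix_unit_inj bbasis _ (matrix_unitP _ bbasis bv)).
split=> [a x y||w bw wv] /=; first by rewrite elin slin.
- by rewrite ev.
- by rewrite e0 // linear_fun0.
Qed.

Lemma matrix_unitZ a u v : beta v ->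
  matrix_unit beta (a *: u) v = a *: matrix_unit beta u v.
Proof.
move=> bv; rewrite -(comp_matrix_unit (s := fun x => a *: x)) // => b x y.
by rewrite scalerDr !scalerA mulrC.
Qed.

(** Some coefficient of a nonzero vector is nonzero, and e_{uu} extracts it because it kills every
    other basis vector. *)
Lemma lin_span_coord (B : set V) x : B `<=` beta -> lin_span B x -> x != 0 ->
  exists2 u, B u & exists2 c : F, c != 0 & matrix_unit beta u u x = c *: u.
Proof.
move=> Bb /lin_spanP[r [c [ur _ ->]]] x0.
have /hasP[u ru /andP[Bu cu]] : has (fun w => (w \in B) && (c w != 0)) r.
  apply: contraNT x0 => /hasPn c0; rewrite big_seq_cond big1 // => w /andP[rw Bw].
  by move: (c0 _ rw); rewrite Bw negbK => /eqP ->; rewrite scale0r.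
have bu : beta u by apply/Bb/set_mem.
exists u; first exact: set_mem.
exists (c u) => //; have [elin eu e0] := matrix_unitP u bbasis bu.
rewrite linear_sum_scale // -big_filter (bigD1_seq u) ?filter_uniq ?mem_filter ?Bu //=.
rewrite big_filter_cond eu big1 ?addr0 // => w /andP[/set_mem Bw wu].
by rewrite e0 ?scaler0 //; apply: Bb.
Qed.

End MatrixUnits.

(** * Consequences of the well-order *)

Section WellOrderedBasis.
Local Open Scope ring_scope.
Variables (F : fieldType) (V : lmodType F) (beta : set V) (le : rel V).
Hypothesis bwo : well_ordered_basis beta le.

Lemma well_ordered_basis_min (C : set V) v : C `<=` beta -> C v ->
  exists2 o, C o & forall w, C w -> le o w.
Proof.
move=> Cb Cv; have [_ wo] := bwo.
have [||o [[/set_mem Co lbo] _]] := wo (mem C).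
- by move=> w /set_mem/Cb/mem_set.
- by exists v; apply: mem_set.
by exists o => // w Cw; apply/lbo/mem_set.
Qed.

Lemma well_ordered_basis_refl v : beta v -> le v v.
Proof.
(* Reflexivity comes from the minimum of the singleton of [v]. *)
move=> bv; have [|//|w] := @well_ordered_basis_min [set v] v; first by move=> w ->.
by move=> -> /(_ v); apply.
Qed.

(** Minimality of [o] makes the map upper triangular; its range is the line through [o]. *)
Lemma UTfin_const o : beta o -> (forall w, beta w -> le o w) ->
  exists2 t, UTfin beta le t & forall w, beta w -> t w = o.
Proof.
move=> bo omin; have [bbasis _] := bwo; have [_ bspan] := bbasis.
have [t tlin to] := linear_extension (fun=> o) bbasis.
exists t => //; split.
  split=> // v bv; rewrite to // -[o]scale1r; apply: lin_span_scale.
  by split=> //; apply: omin.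
exists [set o] => //; apply/seteqP; split=> [_ [x _ <-]|x].
  have /lin_spanP[r [c [_ _ ->]]] : lin_span beta x by rewrite bspan.
  rewrite linear_sum_scale //.
  rewrite (eq_bigr (fun w => c w *: o)) => [|w /set_mem/to -> //].
  by rewrite -scaler_suml; apply: lin_span_scale.
(* The map fixes [o], so each multiple of [o] is its own preimage. *)
move=> /lin_spanP[r [c [_ _ ->]]]; set y := (X in range t X).
exists y => //; rewrite /y linear_sum_scale //.
by apply: eq_bigr => w /set_mem ->; rewrite to.
Qed.

End WellOrderedBasis.

(** * Degrees in a good grading *)

Section GoodGrading.
Local Open Scope ring_scope.
Variables (F : fieldType) (V : lmodType F) (beta : set V) (le : rel V).
Variables (G : groupType) (A : set (V -> V)) (Gamma : G -> set (V -> V)).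
Hypotheses (bwo : well_ordered_basis beta le) (Gammagr : grading A Gamma).
Hypothesis Gammagood : good beta le Gamma.

Let bbasis : lin_basis beta := proj1 bwo.
Let Gammasum := proj1 Gammagr.
Let GammaM := proj2 Gammagr.

Lemma degree_uniq g h (t : V -> V) : t != 0 -> Gamma g t -> Gamma h t -> g = h.
Proof. exact: (direct_sum_index_uniq Gammasum). Qed.

(** e_{vv} is a nonzero idempotent, so its degree satisfies g = g g. *)
Lemma degree_diag v : beta v -> Gamma 1%g (matrix_unit beta v v).
Proof.
move=> bv; have [g Eg] := Gammagood bv bv (well_ordered_basis_refl bwo bv).
have [elin ev _] := matrix_unitP v bbasis bv.
suff <- : g = 1%g by [].
have := GammaM Eg Eg; rewrite comp_matrix_unit // ev.
move=> /(degree_uniq (matrix_unit_neq0 bbasis bv bv) Eg).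
by move=> /(congr1 (fun h => h * g^-1)%g); rewrite mulgK mulgV.
Qed.

Lemma degree_matrix_unit o u v g h k : beta o -> beta u -> beta v ->
  Gamma g (matrix_unit beta o u) -> Gamma h (matrix_unit beta o v) ->
  Gamma k (matrix_unit beta u v) -> k = (g^-1 * h)%g.
Proof.
move=> bo bu bv Eg Eh Ek; have [elin eu _] := matrix_unitP o bbasis bu.
have := GammaM Eg Ek; rewrite comp_matrix_unit // eu.
move=> /(degree_uniq (matrix_unit_neq0 bbasis bo bv) Eh) ->.
by rewrite mulKg.
Qed.

Lemma finite_degree_first_row o (d : V -> G) : UTfin beta le `<=` A -> beta o ->
  (forall v, beta v -> le o v) ->
  (forall v, beta v -> Gamma (d v) (matrix_unit beta o v)) ->
  finite_set [set d v | v in beta].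
Proof.
move=> UTA bo omin dP; have [_ GleA Gdecomp] := Gammasum.
have [t tfin to] := UTfin_const bwo bo omin.
have [[tlin _] _] := tfin; have At := UTA _ tfin.
have [y [[yG yfin tE] _]] := Gdecomp t At.
apply: sub_finite_set (yfin) => _ [v bv <-] /=.
have EvvG := degree_diag bv.
suff : y (d v) \o matrix_unit beta v v = matrix_unit beta o v.
  move=> yE; apply: contraNneq (matrix_unit_neq0 bbasis bo bv) => y0.
  by rewrite -yE y0.
(* Composing the components of [t] with e_{vv} decomposes t e_{vv} = e_{ov}, which is already
   homogeneous of degree [d v]. *)
apply: (direct_sum_component Gammasum (i := d v)
  (y := fun g => y g \o matrix_unit beta v v)).
- exact: dP.
- by move=> g; have := GammaM (yG g) EvvG; rewrite mulg1.
- apply: sub_finite_set (yfin) => g /=; apply: contraNN => /eqP ->.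
  by apply/eqP/funext.
rewrite -(to v bv) -comp_matrix_unit // tE.
(* Listing the support turns both sums into finite ones, over which composition distributes. *)
have /finite_seqP[r rE] := yfin.
have yr g : g \notin undup r -> y g = 0.
  rewrite mem_undup => gr; apply/eqP; apply: contraNT gr => yg.
  by have : [set` r] g by rewrite -rE.
rewrite !(fsbigE (undup r)) ?undup_uniq //.
- by rewrite !fct_sumE.
- by move=> g _ /yr ->.
- by move=> g _ /yr ->.
Qed.

(** If a(v) has coordinate c at u, then e_{uu} a e_{vv} = c e_{uv}; the outer factors have degree 1,
    and c^-1 removes the scalar. Triangularity of a gives u <= v. *)
Lemma degree_neq0 g (a : V -> V) : A `<=` UT beta le -> Gamma g a -> a != 0 ->
  exists u v, [/\ beta u, beta v, le u v & Gamma g (matrix_unit beta u v)].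
Proof.
move=> AUT Ga a0; have [Gsub GleA _] := Gammasum.
have [alin aUT] := AUT _ (GleA _ _ Ga).
have [v bv av] : exists2 v, beta v & a v != 0.
  apply: contrapT => av; move/eqP: a0; apply.
  apply: (linear_basis_eq (proj2 bbasis)) => // [b x y|w bw].
    by rewrite scaler0 addr0.
  by apply: contrapT => /eqP aw; apply: av; exists w.
have [|u [bu uv] [c c0 cE]] := lin_span_coord bbasis _ (aUT v bv) av.
  by move=> w [].
exists u, v; split=> //.
have [elin ev _] := matrix_unitP v bbasis bv.
have [fin _ _] := matrix_unitP u bbasis bu.
have := GammaM (degree_diag bu) (GammaM Ga (degree_diag bv)).
rewrite mul1g mulg1 !comp_matrix_unit // cE matrix_unitZ // => Gc.
have [G0 GD] := Gsub g.
by have := GD c^-1 _ _ Gc G0; rewrite addr0 scalerA mulVf // scale1r.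
Qed.

End GoodGrading.

Unset Implicit Arguments.
Set Strict Implicit.

Theorem lemma22 (F : fieldType) (V : lmodType F) (beta : set V) (le : rel V)
    (G : groupType) (A : set (V -> V)) (Gamma : G -> set (V -> V)) :
  well_ordered_basis beta le ->
  subalgebra A ->
  UTfin beta le `<=` A ->
  A `<=` UT beta le ->
  grading A Gamma ->
  good beta le Gamma ->
  finite_grading Gamma.
Proof.
move=> bwo _ UTA AUT Ggr Ggood; have [[Gsub _ _] _] := Ggr.
have supp g : grading_support Gamma g -> exists u v,
    [/\ beta u, beta v, le u v & Gamma g (matrix_unit beta u v)].
  move=> Gg; apply: contrapT => none; apply: Gg; apply/seteqP; split.
    move=> a Ga; apply: contrapT => /eqP a0; apply: none.
    exact: (degree_neq0 bwo Ggr Ggood AUT Ga a0).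
  by move=> _ ->; case: (Gsub g).
(* An empty basis has no minimum; there [supp] shows that the support is empty. *)
have [[v bv]|b0] := pselect (exists v, beta v); last first.
  apply: sub_finite_set (finite_set0 G) => g /supp[u [_ [bu _ _ _]]].
  by apply: b0; exists u.
have [//|o bo omin] := well_ordered_basis_min bwo (C := beta) _ bv.
have /choice[d dP] : forall w, exists g, beta w -> Gamma g (matrix_unit beta o w).
  (* The degree 1 outside [beta] is only a default making [d] total. *)
  move=> w; have [bw|nbw] := pselect (beta w); last by exists 1%g.
  by have [g] := Ggood _ _ bo bw (omin _ bw); exists g.
have dfin := finite_degree_first_row bwo Ggr Ggood UTA bo omin dP.
apply: sub_finite_set (finite_image2 (fun g h => g^-1 * h)%g dfin dfin).
move=> g /supp[u [w [bu bw uw Eg]]].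
exists (d u); first by exists u.
exists (d w); first by exists w.
by rewrite (degree_matrix_unit bwo Ggr bo bu bw (dP u bu) (dP w bw) Eg).
Qed.
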